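(* Let $G'$ be a graph of order $d$ and let $G=G'\circ 2K_1$. Then $\mathcal{PD}^{TJ}(G)$ is isomorphic to the Hamming graph $H(d,3)$.
   Context: Graphs are finite and simple. $G'\circ 2K_1$ is the corona: the graph obtained from $G'$ by adding, for each vertex $v$ of $G'$, two new leaves adjacent to $v$. For $r\ge 2$ and $d\ge 1$, the Hamming graph $H(d,r)$ has as vertices all $d$-tuples of elements of $\{0,\dots,r-1\}$, two of them adjacent if and only if they differ in exactly one coordinate. For a graph $G$ and a non-empty $S\subseteq V(G)$ define $P^0[S]=S$, $P^1[S]=N[S]$ (the union of the closed neighborhoods of vertices of $S$), and for $i\ge 2$, $P^i[S]=P^{i-1}[S]\cup\{u: N_G(v)\setminus P^{i-1}[S]=\{u\}\text{ for some }v\in P^{i-1}[S]\}$. $S$ is a power dominating set if $P^t[S]=V(G)$ for some $t$; it is minimum if it has the smallest cardinality among power dominating sets. The token jumping (TJ) reconfiguration graph $\mathcal{PD}^{TJ}(G)$ has as vertices all minimum power dominating sets of $G$, with $S$ and $S'$ adjacent if and only if $S$ is obtained from $S'$ by exchanging a single vertex, i.e. $|S\setminus S'|=|S'\setminus S|=1$. *)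

(* Defs.v *)
From HB Require Import structures.
From mathcomp Require Import all_boot.
From mathcomp Require Import boolp.

Set Implicit Arguments.
Unset Strict Implicit.
Unset Printing Implicit Defensive.

Record sgraph := SGraph {
  vertex :> finType;
  adj : rel vertex;
  adj_sym : symmetric adj;
  adj_irr : irreflexive adj }.

Definition isomorphic (G H : sgraph) : Prop :=
  exists2 f : G -> H, bijective f & forall x y, adj (f x) (f y) = adj x y.

Section Corona.
Variable G : sgraph.

(* [inl v] is the vertex v of G; [inr (v, i)], i = 0, 1, are its two leaves. *)
Definition corona_adj : rel (G + G * 'I_2) := fun x y =>
  match x, y with
  | inl u, inl v => adj u v
  | inl u, inr (v, _) => u == v
  | inr (u, _), inl v => u == v
  | inr _, inr _ => false
  end.

Lemma corona_sym : symmetric corona_adj.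
Proof. by case=> [u|[u i]] [v|[v j]] //=; exact: adj_sym. Qed.

Lemma corona_irr : irreflexive corona_adj.
Proof. by case=> [u|[u i]] //=; exact: adj_irr. Qed.

Definition corona_2K1 := SGraph corona_sym corona_irr.

End Corona.

Section Hamming.
Variables d r : nat.

Definition hamming_adj : rel (d.-tuple 'I_r) := fun x y =>
  #|[set i : 'I_d | tnth x i != tnth y i]| == 1.

Lemma hamming_sym : symmetric hamming_adj.
Proof.
move=> x y; rewrite /hamming_adj; congr (_ == 1); apply: eq_card => i.
by rewrite !inE eq_sym.
Qed.

Lemma hamming_irr : irreflexive hamming_adj.
Proof.
move=> x; rewrite /hamming_adj (_ : [set _ | _] = set0) ?cards0 //.
by apply/setP => i; rewrite !inE eqxx.
Qed.

Definition hamming := SGraph hamming_sym hamming_irr.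

End Hamming.

Section PowerDomination.
Variable G : sgraph.
Implicit Types (S : {set G}) (v : G).

Definition nbhd v : {set G} := [set u | adj v u].
Definition closed_nbhd v : {set G} := v |: nbhd v.

Fixpoint observed S (i : nat) : {set G} :=
  match i with
  | 0 => S
  | 1 => \bigcup_(v in S) closed_nbhd v
  | j.+1 => let Q := observed S j in
      Q :|: [set u | [exists v in Q, nbhd v :\: Q == [set u]]]
  end.

Definition power_dominating S : bool :=
  (S != set0) && `[< exists t : nat, observed S t = [set: G] >].

Definition minimum_power_dominating S : bool :=
  power_dominating S
  && [forall S' : {set G}, power_dominating S' ==> (#|S| <= #|S'|)].

Definition min_pds := {S : {set G} | minimum_power_dominating S}.

Definition TJ_adj : rel min_pds := fun A B =>
  (#|val A :\: val B| == 1) && (#|val B :\: val A| == 1).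

Lemma TJ_sym : symmetric TJ_adj.
Proof. by move=> A B; rewrite /TJ_adj andbC. Qed.

Lemma TJ_irr : irreflexive TJ_adj.
Proof. by move=> A; rewrite /TJ_adj setDv cards0. Qed.

Definition PD_TJ := SGraph TJ_sym TJ_irr.

End PowerDomination.

(* Main.v *)
Require Import Defs.
From mathcomp Require Import all_boot.
From mathcomp Require Import boolp.

Set Implicit Arguments.
Unset Strict Implicit.
Unset Printing Implicit Defensive.

(** The vertices of the corona split into blocks, one for each vertex [v] of
    the base graph, consisting of [v] and its two leaves.  A power dominating
    set meets every block: were the block of [v] missed, neither leaf of [v]
    could be observed first, since only [v] can observe them and it always
    sees both of them unobserved ([leaves_unobserved]).  Conversely, every
    transversal of the blocks power dominates: one step observes all of the
    base graph, and at each vertex at most one leaf then remains, which is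
    forced ([transversal_power_dominating]).  As all transversals have the same
    cardinality, the minimum power dominating sets are exactly the transversals
    ([minimum_power_dominatingP]).

    Since each block has three elements, a transversal is a word of length [d]
    over three letters.  Exchanging one token must keep one token per block, so
    it changes exactly one letter ([card_transversalD]), which is adjacency in
    the Hamming graph. *)

Section CoronaTransversals.
Variable G : sgraph.
Local Notation C := (corona_2K1 G).
Implicit Types (v : G) (x y : C) (a : 'I_3) (S : {set C}).
Implicit Types s t : {ffun G -> 'I_3}.

Definition base x : G := match x with inl v => v | inr (v, _) => v end.

Definition digit x : 'I_3 :=
  match x with inl _ => ord0 | inr (_, i) => lift ord0 i end.

Definition point v a : C :=
  if unlift ord0 a is Some i then inr (v, i) else inl v.

Lemma base_point v a : base (point v a) = v.
Proof. by rewrite /point; case: unliftP. Qed.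

Lemma digit_point v a : digit (point v a) = a.
Proof. by rewrite /point; case: unliftP => [i|] ->. Qed.

Lemma point_base_digit x : point (base x) (digit x) = x.
Proof. by case: x => [v|[v i]]; rewrite /point /= ?unlift_none ?liftK. Qed.

Definition transversal t : {set C} := [set x | digit x == t (base x)].

Lemma point_transversal t v a : (point v a \in transversal t) = (a == t v).
Proof. by rewrite inE base_point digit_point. Qed.

Lemma card_transversalD s t :
  #|transversal s :\: transversal t| = #|[set v | s v != t v]|.
Proof.
rewrite -(card_imset [set v | s v != t v] (f := fun v => point v (s v))).
  apply: eq_card => x; rewrite !inE; apply/andP/imsetP => [[nt /eqP es]|].
    by exists (base x); rewrite ?inE -es ?point_base_digit.
  by case=> v; rewrite inE => nst ->; rewrite base_point digit_point.
by move=> v w /(congr1 base); rewrite !base_point.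
Qed.

Lemma card_transversal t : #|transversal t| = #|G|.
Proof.
rewrite -cardsT -(card_imset _ (f := fun v => point v (t v))).
  apply: eq_card => x; rewrite inE; apply/eqP/imsetP => [et|[v _ ->]].
    by exists (base x); rewrite ?inE // -et point_base_digit.
  by rewrite base_point digit_point.
by move=> v w /(congr1 base); rewrite !base_point.
Qed.

(** The default [ord0] is only reached at the blocks that [S] misses; where
    [S] has several tokens in a block, one of them is picked. *)
Definition label S : {ffun G -> 'I_3} :=
  [ffun v => odflt ord0 [pick a | point v a \in S]].

Lemma transversalK : cancel transversal label.
Proof.
move=> t; apply/ffunP => v; rewrite ffunE.
case: pickP => [a|/(_ (t v))]; rewrite point_transversal; first by move/eqP.
by rewrite eqxx.
Qed.

Lemma transversal_label_sub S :
  (forall v, exists a, point v a \in S) -> transversal (label S) \subset S.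
Proof.
move=> meet; apply/subsetP => x; rewrite inE ffunE => /eqP ex.
have [a Sa] := meet (base x); move: ex.
case: pickP => [b Sb /= eb|/(_ a)]; last by rewrite Sa.
by rewrite -(point_base_digit x) eb.
Qed.

(** A leaf of [v] can only be forced by [v], and [v] forces nothing as long as
    it has two unobserved neighbours. *)
Lemma leaves_unobserved S v n i :
  (forall a, point v a \notin S) -> (inr (v, i) : C) \notin observed S n.
Proof.
move=> miss; have Sl j : (inr (v, j) : C) \notin S.
  by rewrite -(point_base_digit (inr (v, j))) miss.
have Sv : (inl v : C) \notin S by rewrite -(point_base_digit (inl v)) miss.
elim: n i => [|[|n] IHn] i //.
  apply/bigcupP => -[[w|[w j]] Sx]; rewrite !inE /= ?orbF.
    by move/eqP=> ew; rewrite -ew Sx in Sv.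
  by move/eqP=> [ev ej]; move: (Sl i); rewrite ev ej Sx.
rewrite [observed _ _]/= in_setU negb_or IHn inE /=.
apply/existsP => -[y /andP[_ /eqP eN]].
have: (inr (v, i) : C) \in [set (inr (v, i) : C)] by rewrite inE.
rewrite -eN !inE => /andP[_]; case: y eN => [w|[w k]] //= eN /eqP ew.
(* the other leaf of [v] is an unobserved neighbour as well *)
have: (inr (v, rev_ord i) : C) \in nbhd (inl w : C) :\: observed S n.+1.
  by rewrite in_setD IHn inE /= ew eqxx.
rewrite [_ :\: _]eN inE => /eqP[/(congr1 val)].
by case: i {eN} => [[|[|?]] ?].
Qed.

Lemma power_dominating_meets S v :
  power_dominating S -> exists a, point v a \in S.
Proof.
case/andP=> _ /asboolP[n obs]; apply/existsP; apply: contraT => /existsPn miss.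
by have := leaves_unobserved n ord0 miss; rewrite obs inE.
Qed.

Lemma transversal_power_dominating t :
  0 < #|G| -> power_dominating (transversal t).
Proof.
move=> G_gt0; apply/andP; split.
  by rewrite -card_gt0 card_transversal.
apply/asboolP; exists 2; apply/setP => x; rewrite [RHS]inE.
rewrite [observed _ 2]/=; set Q := \bigcup_(_ in _) _.
have Qt v y : y \in closed_nbhd (point v (t v)) -> y \in Q.
  by move=> yN; apply/bigcupP; exists (point v (t v)); rewrite ?point_transversal.
have Qv v : (inl v : C) \in Q.
  apply: (Qt v); rewrite !inE /point.
  by case: unliftP => [i _|_] /=; rewrite eqxx ?orbT.
have [Qx|nQx] := boolP (x \in Q); first by rewrite in_setU Qx.
case: x nQx => [v|[v i]] nQi; first by rewrite Qv in nQi.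
rewrite inE (negPf nQi) inE; apply/existsP; exists (inl v).
rewrite Qv; apply/eqP/setP => y; rewrite in_set1 in_setD inE.
apply/andP/eqP => [[nQy]|->]; last by rewrite nQi /= eqxx.
case: y nQy => [w|[w j] nQj /= /eqP vw]; first by rewrite Qv.
rewrite -{}vw in nQj *.
(* two leaves outside [Q] differ from the token of their block, and there are
   only two leaves *)
have := Qt v; rewrite /point; case: unliftP => [k _|_] Nk; last first.
  by case/negP: nQi; apply: Nk; rewrite !inE /= eqxx.
have neq l : (inr (v, l) : C) \notin Q -> val l != val k.
  by apply: contra => /eqP/val_inj->; apply: Nk; rewrite !inE eqxx.
congr (inr (v, _)); apply: val_inj; move: (neq _ nQi) (neq _ nQj).
by case: i j k {nQi nQj Nk neq} => [[|[|?]] ?] [[|[|?]] ?] [[|[|?]] ?].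
Qed.

(** A power dominating set contains a transversal, and transversals are all
    equally large power dominating sets. *)
Lemma minimum_power_dominatingP S :
  0 < #|G| -> reflect (transversal (label S) = S) (minimum_power_dominating S).
Proof.
move=> G_gt0.
have sub S' : power_dominating S' -> transversal (label S') \subset S'.
  by move=> pdS'; apply: transversal_label_sub => v; apply: power_dominating_meets.
apply: (iffP andP) => [[pdS /forallP minS]|<-].
  apply/eqP; rewrite eqEcard sub //=.
  exact: implyP (minS _) (transversal_power_dominating _ G_gt0).
split; first exact: transversal_power_dominating.
apply/forallP => S'; apply/implyP => /sub/subset_leq_card.
by rewrite !card_transversal.
Qed.

End CoronaTransversals.

Theorem proposition5p5 (d : nat) (d_gt0 : 0 < d) (G' : sgraph)
    (order_G' : #|G'| = d) :
  isomorphic (PD_TJ (corona_2K1 G')) (hamming d 3).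
Proof.
subst d; pose C := corona_2K1 G'.
pose word (A : min_pds C) : #|G'|.-tuple 'I_3 :=
  [tuple label (val A) (enum_val i) | i < #|G'|].
pose tokens (u : #|G'|.-tuple 'I_3) : {set C} :=
  transversal [ffun v => tnth u (enum_rank v)].
have tokens_min u : minimum_power_dominating (tokens u).
  by apply/(minimum_power_dominatingP _ d_gt0); rewrite transversalK.
have valK (A : min_pds C) : transversal (label (val A)) = val A.
  exact/(minimum_power_dominatingP _ d_gt0)/(valP A).
exists word; first exists (fun u => Sub (tokens u) (tokens_min u)) => [A|u].
- apply: val_inj; rewrite /= -[RHS]valK; congr transversal.
  by apply/ffunP => v; rewrite ffunE tnth_mktuple enum_rankK.
- apply: eq_from_tnth => i.
  by rewrite tnth_mktuple SubK transversalK ffunE enum_valK.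
move=> A B; rewrite /= /hamming_adj /TJ_adj -(valK A) -(valK B).
rewrite !card_transversalD.
have -> : #|[set i | tnth (word A) i != tnth (word B) i]|
        = #|[set v | label (val A) v != label (val B) v]|.
  rewrite -(card_imset _ (@enum_val_inj _ G')); apply: eq_card => v.
  rewrite inE; apply/imsetP/idP => [[i + ->]|neq].
    by rewrite inE !tnth_mktuple.
  by exists (enum_rank v); rewrite ?inE ?tnth_mktuple enum_rankK.
have -> : [set v | label (val B) v != label (val A) v]
        = [set v | label (val A) v != label (val B) v].
  by apply/setP => v; rewrite !inE eq_sym.
by rewrite andbb.
Qed.
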